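(* Let $n\ge 2$ be even, let $a_1,\ldots,a_n\in\mathbb{C}$ be pairwise distinct, and let $b_1,\ldots,b_{n-1}\in\mathbb{C}$ satisfy $b_1\cdots b_{n-1}\neq 0$. Then every non-constant factor of $\chi_n(\lambda,w)$ in $\mathbb{C}[\lambda,w]$ that is monic in $\lambda$ has even degree in $\lambda$.
   Context: For $a_1,\ldots,a_n,b_1,\ldots,b_{n-1}\in\mathbb{C}$ let $A=\operatorname{diag}(a_1,\ldots,a_n)$ and let $B$ be the $n\times n$ symmetric tridiagonal matrix with zero diagonal and entries $B_{i,i+1}=B_{i+1,i}=b_i$ for $1\le i\le n-1$. The spectral polynomial is $\chi_n(\lambda,w)=\det(\lambda I+A+wB)\in\mathbb{C}[\lambda,w]$. *)

(* Defs.v *)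
From mathcomp Require Import all_boot all_algebra.
From mathcomp Require Import reals.
From mathcomp.real_closed Require Import complex.

Set Implicit Arguments.
Unset Strict Implicit.
Unset Printing Implicit Defensive.

Import GRing.Theory.
Local Open Scope ring_scope.

Section SpectralPolynomial.
Variables (C : comNzRingType) (n : nat).
Implicit Types (a : n.-tuple C) (b : n.-1.-tuple C).

Definition diagA a : 'M[C]_n := diag_mx (\row_i tnth a i).

(* Indices start at 0, so that b`_i is the entry in positions (i, i+1) and    *)
(* (i+1, i); here i < n - 1, so the default value of nth is never used.       *)
Definition tridiagB b : 'M[C]_n :=
  \matrix_(i, j) if j == i.+1 :> nat then b`_i
                 else if i == j.+1 :> nat then b`_j else 0.

(* C[lambda, w] is encoded as C[w][lambda]: the outer variable 'X is lambda,  *)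
(* the constant 'X%:P is w, and a scalar c is c%:P%:P. Hence being monic, and *)
(* the degree (size p).-1, are relative to lambda.                            *)
Definition spectral_poly a b : {poly {poly C}} :=
  \det ('X%:M + map_mx (polyC \o polyC) (diagA a)
        + 'X%:P *: map_mx (polyC \o polyC) (tridiagB b)).

End SpectralPolynomial.

(* Main.v *)
Require Import Defs.
From mathcomp Require Import all_boot all_algebra.
From mathcomp Require Import reals.
From mathcomp.real_closed Require Import complex.
From mathcomp Require Import separable ring zify.

Set Implicit Arguments.
Unset Strict Implicit.
Unset Printing Implicit Defensive.

Import GRing.Theory.
Local Open Scope ring_scope.

(** Let chi = p q with p monic in lambda, of degree d.

    The factor p is even in w. Conjugating by the diagonal matrix of the signs
    (-1)^i changes B into -B, so chi(lambda, -w) = chi(lambda, w)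
    ([flip_w_spectral_poly]), and p(lambda, -w) q(lambda, -w) is another monic
    factorization of chi. The two factorizations agree at w = 0, where
    chi(lambda, 0) is the product of the lambda + a_i; as the a_i are distinct,
    p(lambda, 0) and q(lambda, 0) are coprime. A factorization into monic
    factors that are coprime at w = 0 is determined by its value at w = 0 (the
    uniqueness part of Hensel's lemma, [coprime_monic_factor_unique]), hence
    p(lambda, -w) = p(lambda, w) ([flip_w_factor]).

    The monomial w^d occurs in p ([factor_coef_w_neq0]). The top homogeneous
    part of chi for the total degree is det(lambda I + w B), of degree n. The
    total degrees of p and q are at least d and n - d, hence equal to these, and
    the top parts of p and q multiply to det(lambda I + w B). The coefficient of
    w^n there is det B, which is nonzero when n is even and all b_i are nonzero
    ([det_tridiagB_neq0]); so the coefficient of w^d in p is nonzero.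

    A polynomial even in w in which w^d occurs has d even. *)

(** * Determinants of linear matrix pencils *)

Lemma size_bigM_linear (R : nzSemiRingType) (I : Type) (s : seq I)
    (f : I -> {poly R}) :
  (forall i, size (f i) <= 2)%N ->
  (size (\prod_(i <- s) f i)%R <= (size s).+1)%N.
Proof.
move=> szf; elim: s => [|i s IHs]; first by rewrite big_nil size_poly1.
rewrite big_cons (leq_trans (size_polyMleq _ _)) //= -subn1 leq_subLR.
exact: leq_add (szf i) IHs.
Qed.

Lemma coef_bigM_linear (R : nzSemiRingType) (I : Type) (s : seq I)
    (f : I -> {poly R}) :
  (forall i, size (f i) <= 2)%N ->
  (\prod_(i <- s) f i)`_(size s) = \prod_(i <- s) (f i)`_1.
Proof.
move=> szf; elim: s => [|i s IHs]; first by rewrite !big_nil coef1.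
rewrite !big_cons /= coefM big_ord_recl big_ord_recl /= subn0 subSS subn0 IHs.
rewrite [in X in _ * X + _]nth_default ?size_bigM_linear // mulr0 add0r.
rewrite [X in _ + X](_ : _ = 0) ?addr0 //; apply: big1 => j _.
by rewrite nth_default ?mul0r // (leq_trans (szf i)).
Qed.

Section Pencil.
Variables (R : comNzRingType) (n : nat) (A B : 'M[R]_n).

(** The matrix A + t B of polynomials in t. *)
Definition pencil : 'M[{poly R}]_n := map_mx polyC A + 'X *: map_mx polyC B.

Lemma size_pencil_entry i j : (size (pencil i j) <= 2)%N.
Proof.
rewrite !mxE (leq_trans (size_polyD _ _)) // geq_max.
rewrite (leq_trans (size_polyC_leq1 _)) //.
rewrite (leq_trans (size_polyMleq _ _)) // size_polyX -subn1 leq_subLR.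
exact: leq_add (leqnn 2) (size_polyC_leq1 _).
Qed.

Lemma size_det_pencil : (size (\det pencil) <= n.+1)%N.
Proof.
apply: (leq_trans (size_sum _ _ _)); apply/bigmax_leqP => s _.
have szP (g : 'I_n -> 'I_n) : (size (\prod_i pencil i (g i))%R <= n.+1)%N.
  rewrite -[X in (_ <= X.+1)%N](size_enum_ord n) enumT.
  by apply: size_bigM_linear => i; exact: size_pencil_entry.
by rewrite mulr_sign; case: ifP; rewrite ?size_polyN => _; exact: szP.
Qed.

Lemma coef_det_pencil : (\det pencil)`_n = \det B.
Proof.
rewrite coef_sum; apply: eq_bigr => s _.
rewrite -signr_odd -[_ ^+ _](rmorph_sign polyC) coefCM signr_odd; congr (_ * _).
rewrite -[X in _`_X](size_enum_ord n) enumT coef_bigM_linear => [|i].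
  apply: eq_bigr => i _.
  by rewrite !mxE coefD coefC add0r coefXM coefC.
exact: size_pencil_entry.
Qed.

End Pencil.

(** * Specializations of polynomials in lambda and w *)

Section Morphisms.
Variable R : comNzRingType.
Implicit Types p q : {poly {poly R}}.

(** The specialization f(lambda, 0), a polynomial in lambda. *)
Definition at_w0 : {rmorphism {poly {poly R}} -> {poly R}} :=
  map_poly (horner_eval (0 : R)).

(** The substitution f(lambda, -w). *)
Definition flip_w : {rmorphism {poly {poly R}} -> {poly {poly R}}} :=
  map_poly (comp_poly (- 'X : {poly R})).

(** The substitution f(s t, t), as a polynomial in t (the outer variable) over
    the polynomials in s: its degree in t is the total degree of f, and its
    leading coefficient is the top homogeneous part of f, dehomogenized at
    w = 1. *)
Definition homog_subst : {rmorphism {poly {poly R}} -> {poly {poly R}}} :=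
  horner_eval ('X%:P * 'X : {poly {poly R}}) \o map_poly (map_poly polyC).

Lemma at_w0E : (at_w0 'X = 'X) * (at_w0 'X%:P = 0) *
  (forall c, at_w0 c%:P%:P = c%:P).
Proof.
split; [split|move=> c]; rewrite /= ?map_polyX // map_polyC /=.
  by rewrite /horner_eval hornerX.
by rewrite /horner_eval hornerC.
Qed.

Lemma flip_wE : (flip_w 'X = 'X) * (flip_w 'X%:P = - 'X%:P) *
  (forall c, flip_w c%:P%:P = c%:P%:P).
Proof.
split; [split|move=> c]; rewrite /= ?map_polyX // map_polyC /=.
  by rewrite comp_polyX rmorphN.
by rewrite comp_polyC.
Qed.

Lemma homog_substE : (homog_subst 'X = 'X%:P * 'X) * (homog_subst 'X%:P = 'X) *
  (forall c, homog_subst c%:P%:P = c%:P%:P).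
Proof.
split; [split|move=> c]; rewrite /= /horner_eval.
- by rewrite map_polyX hornerX.
- by rewrite map_polyC hornerC /= map_polyX.
- by rewrite map_polyC hornerC /= map_polyC.
Qed.

Lemma at_w0_flip_w p : at_w0 (flip_w p) = at_w0 p.
Proof.
apply/polyP => i; rewrite !coef_map /= /horner_eval horner_comp.
by rewrite !hornerE oppr0.
Qed.

Lemma coef_comp_polyNX (p : {poly R}) k : (p \Po (- 'X))`_k = (-1) ^+ k * p`_k.
Proof.
elim/poly_ind: p k => [|p c IHp] k; first by rewrite comp_poly0 !coef0 mulr0.
rewrite comp_poly_MXaddC !coefD !coefC mulrN coefN !coefMX.
case: k => [|k] /=; first by rewrite oppr0 !add0r expr0 mul1r.
by rewrite !addr0 IHp exprS mulN1r mulNr.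
Qed.

(** The monomial lambda^i w^j is sent to s^i t^(i + j). *)
Lemma coef_homog_subst p k i :
  (homog_subst p)`_k`_i = if (i <= k)%N then p`_i`_(k - i) else 0.
Proof.
pose q := map_poly (map_poly (polyC : R -> {poly R})) p.
have -> : homog_subst p = \sum_(j < size q) q`_j * ('X%:P * 'X) ^+ j.
  exact: horner_coef.
have qE j : (q`_j * ('X%:P * 'X) ^+ j)`_k`_i =
            if (j <= k)%N && (i == j) then p`_j`_(k - j) else 0.
  rewrite exprMn -rmorphXn mulrA coefMXn ltnNge; case: leqP => //= _.
    by rewrite coefMC coef_map /= coef_map /= coefCM coefXn mulr_natr mulrb.
  by rewrite coef0.
rewrite !coef_sum (eq_bigr _ (fun (j : 'I_(size q)) _ => qE j)) -big_mkcond /=.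
have [i_lt|i_ge] := ltnP i (size q); last first.
  rewrite big_pred0 => [|j]; last first.
    have [ij|_] := eqVneq i (j : nat); last by rewrite andbF.
    by rewrite ij leqNgt ltn_ord in i_ge.
  have /(congr1 (fun f : {poly {poly R}} => f`_(k - i)`_0)) : q`_i = 0.
    by rewrite nth_default.
  rewrite coef_map /=.
  by rewrite coef_map /= coefC eqxx !coef0 => ->; case: ifP.
case: leqP => ik.
  rewrite (big_pred1 (Ordinal i_lt)) // => j /=.
  rewrite -val_eqE /= eq_sym.
  by have [->|_] := eqVneq (j : nat) i; rewrite ?andbF // ik.
rewrite big_pred0 // => j.
by have [<-|_] := eqVneq i (j : nat); rewrite ?andbF // leqNgt ik.
Qed.

End Morphisms.
Arguments at_w0 {R}.
Arguments flip_w {R}.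
Arguments homog_subst {R}.

(** * Invertibility of the tridiagonal matrix *)

(** The relations v B = 0 read v_(j-1) b_(j-1) + v_(j+1) b_j = 0. With 0-based
    indices they annihilate the odd entries of v from the left end and, as n is
    even, the even entries from the right end. *)
Lemma det_tridiagB_neq0 (F : fieldType) n (b : n.-1.-tuple F) :
  ~~ odd n -> \prod_(i < n.-1) tnth b i != 0 -> \det (tridiagB b) != 0.
Proof.
move=> n_even /prodf_neq0 b_neq0; apply/det0P => -[v v_neq0 vB0].
have b0 i : (i.+1 < n)%N -> b`_i != 0.
  move=> i_lt; have i_lt' : (i < n.-1)%N by lia.
  by have := b_neq0 (Ordinal i_lt') isT; rewrite (tnth_nth 0).
(* u extends v by 0 beyond index n - 1. *)
pose u k : F := if insub k is Some i then v 0 i else 0.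
have u_ge k : (n <= k)%N -> u k = 0.
  by move=> le_nk; rewrite /u insubF // ltnNge le_nk.
have uE (j : 'I_n) : u j = v 0 j by rewrite /u valK.
have rec j : (j < n)%N ->
    (if j is j'.+1 then u j' * b`_j' else 0) + u j.+1 * b`_j = 0.
  move=> j_lt.
  have -> : (if j is j'.+1 then u j' * b`_j' else 0) =
            \sum_(i < n) (if j == i.+1 then u i * b`_i else 0).
    case: j j_lt => [|j] j_lt; first by rewrite big1.
    have := big_ord1_eq +%R (fun i => u i * b`_i) j n.
    by rewrite ltnW // -big_mkcond => <-; apply: eq_bigl => i; rewrite eqSS eq_sym.
  have -> : u j.+1 * b`_j =
            \sum_(i < n) (if i == j.+1 :> nat then u i * b`_j else 0).
    rewrite -big_mkcond (big_ord1_eq +%R (fun i => u i * b`_j)).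
    by case: ltnP => // /u_ge ->; rewrite mul0r.
  have vBj : (v *m tridiagB b) 0 (Ordinal j_lt) = 0 by rewrite vB0 mxE.
  rewrite -big_split -[RHS]vBj mxE; apply: eq_bigr => i _; rewrite !mxE uE /=.
  have [->|_] := eqVneq j i.+1; last by case: ifP; rewrite ?add0r ?mulr0.
  by rewrite ltn_eqF ?addr0 // ltnS leqnSn.
have u_odd k : u k.*2.+1 = 0.
  elim: k => [|k IHk].
    have [/u_ge//|n_gt1] := leqP n 1.
    have /eqP := rec 0%N (ltnW n_gt1).
    by rewrite add0r mulf_eq0 (negPf (b0 _ _)) // orbF => /eqP.
  have [/u_ge//|k_lt] := leqP n k.+1.*2.+1.
  have /eqP := rec _ (ltnW k_lt).
  by rewrite doubleS IHk mul0r add0r mulf_eq0 (negPf (b0 _ _)) // orbF => /eqP.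
have u_even k : (k.*2 <= n)%N -> u (n - k.*2)%N = 0.
  elim: k => [|k IHk] k_le; first by rewrite subn0 u_ge.
  have eq1 : (n - k.*2 = (n - k.+1.*2).+2)%N by lia.
  have lt1 : ((n - k.+1.*2).+1 < n)%N by lia.
  have /eqP := rec _ lt1.
  rewrite -eq1 IHk; last by lia.
  by rewrite mul0r addr0 mulf_eq0 (negPf (b0 _ _)) // orbF => /eqP.
case/eqP: v_neq0; apply/rowP => j; rewrite -uE mxE.
have [j_odd|j_even] := boolP (odd j).
  by rewrite -(odd_double_half j) j_odd u_odd.
have -> : (j = n - (n - j)./2.*2 :> nat)%N.
  by have := ltn_ord j; lia.
by rewrite u_even //; lia.
Qed.

(** * Uniqueness of factorizations that are coprime at w = 0 *)

(** With D = p - p', the equation D q = p' (q' - q) holds. If p' and q have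
    positive degree, their resultant r is a combination of both, so p' divides
    r D; if q = 1, take r = 1. Since D has smaller degree than the monic p', and
    r is nonzero (at w = 0, by coprimality), D vanishes. *)
Lemma coprime_monic_factor_unique (F : fieldType)
    (p q p' q' : {poly {poly F}}) :
  p \is monic -> q \is monic -> p' \is monic -> p * q = p' * q' ->
  at_w0 p = at_w0 p' -> coprimep (at_w0 p) (at_w0 q) -> p = p'.
Proof.
move=> p_mon q_mon p'_mon eq_pq eq_p0 cop.
have at0_lead (r : {poly {poly F}}) : r \is monic -> horner_eval 0 (lead_coef r) != 0.
  by move=> /monicP ->; rewrite /horner_eval hornerC oner_neq0.
have at0_size (r : {poly {poly F}}) : r \is monic -> size (at_w0 r) = size r.
  by move=> /at0_lead; exact: size_map_poly_id0.
have eq_sz : size p = size p' by rewrite -!at0_size // eq_p0.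
apply/eqP; rewrite -subr_eq0; set D := p - p'.
have D_lt : (size D < size p')%N.
  have p'_gt0 : (0 < size p')%N by rewrite size_poly_gt0 monic_neq0.
  rewrite -(prednK p'_gt0) ltnS; apply/leq_sizeP => i.
  rewrite leq_eqVlt coefB => /orP[/eqP <-|i_gt].
    by rewrite -{1}eq_sz -!/(lead_coef _) (monicP p_mon) (monicP p'_mon) subrr.
  by rewrite (prednK p'_gt0) in i_gt; rewrite !nth_default ?subrr ?eq_sz.
have DqE : D * q = p' * (q' - q) by rewrite mulrBl mulrBr eq_pq.
have [p'_gt1|p'_le1] := ltnP 1 (size p'); last first.
  by rewrite -size_poly_eq0 -leqn0 -ltnS (leq_trans D_lt).
suff [r r_neq0 [s rDE]] : exists2 r : {poly F}, r != 0 &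
    exists s, r%:P * D = p' * s.
  have [s0|s_neq0] := eqVneq s 0.
    by move/eqP: rDE; rewrite s0 mulr0 mulf_eq0 polyC_eq0 (negPf r_neq0).
  have := size_monicM p'_mon s_neq0.
  rewrite -rDE mul_polyC size_scale // => szD.
  by move: D_lt s_neq0; rewrite szD -size_poly_gt0; lia.
have [q_gt1|q_le1] := ltnP 1 (size q); last first.
  exists 1; rewrite ?oner_neq0 //; exists (q' - q).
  have q_cst := size1_polyC q_le1.
  by move/monicP: q_mon DqE; rewrite q_cst lead_coefC => ->; rewrite mulr1 mul1r.
have [[u v] _ /= res_eq] := resultant_in_ideal p'_gt1 q_gt1.
exists (resultant p' q).
  have := map_resultant (at0_lead _ p'_mon) (at0_lead _ q_mon).
  apply: contra_eq_neq => ->.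
  rewrite [X in X != _]horner0 eq_sym resultant_eq0.
  by rewrite -leqNgt; move: cop; rewrite eq_p0 => /eqP ->.
exists (u * D + v * (q' - q)).
by rewrite res_eq mulrDl -[v * q * D]mulrA [q * D]mulrC DqE; ring.
Qed.

Lemma flip_w_factor (F : fieldType) (p q : {poly {poly F}}) :
  p \is monic -> q \is monic -> flip_w (p * q) = p * q ->
  separable_poly (at_w0 (p * q)) -> flip_w p = p.
Proof.
move=> p_mon q_mon pq_even; rewrite rmorphM separable_mul => /and3P[_ _ cop].
symmetry; apply: (coprime_monic_factor_unique p_mon q_mon _ _ _ cop).
- exact: monic_map.
- by rewrite -pq_even rmorphM.
- by rewrite at_w0_flip_w.
Qed.

(** * The spectral polynomial *)

Section SpectralProperties.
Variables (R : comNzRingType) (n : nat) (a : n.-tuple R) (b : n.-1.-tuple R).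

Let M : 'M[{poly {poly R}}]_n :=
  'X%:M + map_mx (polyC \o polyC) (diagA a)
        + 'X%:P *: map_mx (polyC \o polyC) (tridiagB b).

(** As a characteristic polynomial over the ring of polynomials in w, the
    spectral polynomial is monic of degree n in lambda. *)
Lemma spectral_polyE : spectral_poly a b =
  char_poly (- (map_mx polyC (diagA a) + 'X *: map_mx polyC (tridiagB b))).
Proof.
congr (\det _); apply/matrixP => i j; rewrite !mxE /=.
by rewrite rmorphN rmorphD rmorphM /= opprK addrA.
Qed.

Lemma spectral_poly_monic : spectral_poly a b \is monic.
Proof. by rewrite spectral_polyE char_poly_monic. Qed.

Lemma size_spectral_poly : size (spectral_poly a b) = n.+1.
Proof. by rewrite spectral_polyE size_char_poly. Qed.

Lemma at_w0_spectral_poly :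
  at_w0 (spectral_poly a b) = \prod_(c <- map -%R a) ('X - c%:P).
Proof.
rewrite big_map big_tuple -det_map_mx.
have at_w0M i j : at_w0 (M i j) = ('X + (tnth a i)%:P) *+ (i == j).
  by rewrite !mxE !rmorphD rmorphM rmorphMn !at_w0E mul0r addr0 mulrnDl !rmorphMn.
rewrite det_trig => [|].
  by apply: eq_bigr => i _; rewrite mxE at_w0M eqxx rmorphN opprK.
apply/is_trig_mxP => i j i_lt_j; rewrite mxE at_w0M.
by case: eqP i_lt_j => // ->; rewrite ltnn.
Qed.

(** The matrix S of signs is an involution that conjugates A + w B to A - w B. *)
Lemma flip_w_spectral_poly : flip_w (spectral_poly a b) = spectral_poly a b.
Proof.
pose S : 'M[{poly {poly R}}]_n := diag_mx (\row_i (-1) ^+ i).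
have SK : S *m S = 1%:M.
  rewrite mulmx_diag -diag_const_mx; congr diag_mx.
  by apply/rowP => i; rewrite !mxE -signr_odd -signr_addb addbb.
have -> : spectral_poly a b = \det M by [].
rewrite -det_map_mx (_ : map_mx _ _ = S *m M *m S); last first.
  rewrite mul_diag_mx mul_mx_diag; apply/matrixP => i j; rewrite !mxE.
  rewrite !rmorphD rmorphM rmorphMn !flip_wE /=.
  rewrite mulrAC -exprD -signr_odd oddD.
  have [->|i_neq_j] := eqVneq i j.
    by rewrite addbb ltn_eqF // mulr0 mulr0 mul1r.
  have [->|_] := eqVneq (j : nat) i.+1.
    by rewrite /= addbN addbb !mulr0n; ring.
  have [->|_] := eqVneq (i : nat) j.+1.
    by rewrite /= addNb addbb !mulr0n; ring.
  by rewrite !mulr0n; ring.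
by rewrite !det_mulmx mulrAC -det_mulmx SK det1 mul1r.
Qed.

Lemma homog_subst_spectral_poly : homog_subst (spectral_poly a b) =
  \det (pencil (map_mx polyC (diagA a)) ('X%:M + map_mx polyC (tridiagB b))).
Proof.
rewrite -det_map_mx; congr (\det _); apply/matrixP => i j; rewrite !mxE.
by rewrite !rmorphD rmorphM rmorphMn !homog_substE /= !rmorphMn; ring.
Qed.

End SpectralProperties.

(** * Monic factors of the spectral polynomial *)

(** The total degree is at least the degree in lambda. *)
Lemma size_homog_subst (R : comNzRingType) (p : {poly {poly R}}) :
  p \is monic -> (size p <= size (homog_subst p))%N.
Proof.
move=> p_mon; have p_gt0 : (0 < size p)%N by rewrite size_poly_gt0 monic_neq0.
rewrite -(prednK p_gt0); apply: contraLR isT; rewrite -leqNgt => /leq_sizeP h.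
have := coef_homog_subst p (size p).-1 (size p).-1.
rewrite h // coef0 leqnn subnn -/(lead_coef p) (monicP p_mon) coef1.
by move/esym/eqP; rewrite oner_eq0.
Qed.

(** The coefficient of w^d in p is nonzero, where d is the degree of p in
    lambda. *)
Lemma factor_coef_w_neq0 (F : fieldType) n (a : n.-tuple F)
    (b : n.-1.-tuple F) (p q : {poly {poly F}}) :
  \det (tridiagB b) != 0 -> p \is monic -> q \is monic ->
  spectral_poly a b = p * q -> p`_0`_(size p).-1 != 0.
Proof.
move=> detB p_mon q_mon chiE.
have p_gt0 : (0 < size p)%N by rewrite size_poly_gt0 monic_neq0.
have q_gt0 : (0 < size q)%N by rewrite size_poly_gt0 monic_neq0.
have hp_ge := size_homog_subst p_mon; have hq_ge := size_homog_subst q_mon.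
have hp0 : homog_subst p != 0 by rewrite -size_poly_gt0 (leq_trans p_gt0).
have hq0 : homog_subst q != 0 by rewrite -size_poly_gt0 (leq_trans q_gt0).
have sz_pq : (size p + size q = n.+2)%N.
  have := size_spectral_poly a b; rewrite chiE size_monicM ?monic_neq0 //.
  by rewrite -(prednK p_gt0) -(prednK q_gt0) addnS addSn /= => ->.
pose A := map_mx (polyC : F -> {poly F}) (diagA a).
pose B := 'X%:M + map_mx (polyC : F -> {poly F}) (tridiagB b).
have hE : homog_subst p * homog_subst q = \det (pencil A B).
  by rewrite -rmorphM -chiE homog_subst_spectral_poly.
have sz_h : (size (homog_subst p) + size (homog_subst q) <= n.+2)%N.
  have := size_det_pencil A B.
  by rewrite -hE size_mul // -subn1 leq_subLR.
have sz_hp : size (homog_subst p) = size p.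
  apply/eqP; rewrite eqn_leq hp_ge andbT -(leq_add2r (size q)) sz_pq.
  by rewrite (leq_trans _ sz_h) // leq_add2l.
have sz_hq : size (homog_subst q) = size q.
  apply/eqP; rewrite eqn_leq hq_ge andbT -(leq_add2l (size p)) sz_pq.
  by rewrite (leq_trans _ sz_h) // leq_add2r.
have sz_h_pq : size (homog_subst p * homog_subst q) = n.+1.
  by rewrite size_mul // sz_hp sz_hq sz_pq.
have detBE : lead_coef (homog_subst p) * lead_coef (homog_subst q) = \det B.
  by rewrite -lead_coefM lead_coefE sz_h_pq hE coef_det_pencil.
(* At s = 0 the leading coefficient det(s I + B) becomes det B. *)
have B0 : map_mx (horner_eval (0 : F)) B = tridiagB b.
  apply/matrixP => i j; rewrite !mxE /horner_eval hornerD hornerC.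
  by rewrite hornerMn hornerX mul0rn add0r.
move: detB; rewrite -B0 det_map_mx -detBE rmorphM mulf_eq0 negb_or.
case/andP=> + _; rewrite [X in X != 0 -> _]horner_coef0 lead_coefE sz_hp.
by rewrite coef_homog_subst subn0.
Qed.

Theorem proposition2p3 (R : realType) (n : nat)
    (a : n.-tuple R[i]) (b : n.-1.-tuple R[i])
    (n_ge2 : (2 <= n)%N) (n_even : ~~ odd n)
    (a_distinct : uniq a) (b_neq0 : \prod_(i < n.-1) tnth b i != 0)
    (p : {poly {poly R[i]}}) :
  (exists q : {poly {poly R[i]}}, spectral_poly a b = p * q) ->
  (forall c : R[i], p <> c%:P%:P) ->
  p \is monic ->
  ~~ odd (size p).-1.
Proof.
move=> [q chiE] _ p_mon.
have q_mon : q \is monic by rewrite -(monicMl _ p_mon) -chiE spectral_poly_monic.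
have p_even : flip_w p = p.
  apply: (flip_w_factor p_mon q_mon); rewrite -chiE ?flip_w_spectral_poly //.
  rewrite at_w0_spectral_poly separable_prod_XsubC map_inj_uniq //.
  exact: oppr_inj.
have p0d := factor_coef_w_neq0 (det_tridiagB_neq0 n_even b_neq0) p_mon q_mon chiE.
apply: contra p0d => d_odd.
(* Evenness in w negates the coefficient of w^d when d is odd. *)
have := congr1 (fun f : {poly {poly R[i]}} => f`_0`_(size p).-1) p_even.
rewrite coef_map /= coef_comp_polyNX -signr_odd d_odd mulN1r => /eqP.
by rewrite eq_sym -addr_eq0 -mulr2n Num.Theory.mulrn_eq0.
Qed.
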